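(* Let $\rho_0,\rho_1$ be states on a finite-dimensional complex Hilbert space $H$, each with prior probability $1/2$. For $N\ge1$ let $R=R_N$ be the average error probability of the test which applies a fidelity-optimal measurement for $(\rho_0,\rho_1)$ separately and independently to each of $N$ identical copies of the state and then uses the optimal (maximum likelihood) decision rule on the observed outcomes. Then $$\limsup_{N\to\infty}\frac1N\log R_N\le\log F(\rho_0,\rho_1),$$ where $F(\rho_0,\rho_1)=\operatorname{tr}\sqrt{\sqrt{\rho_0}\,\rho_1\sqrt{\rho_0}}$ is the fidelity (and $\log0=-\infty$).
   Context: A state on a finite-dimensional complex Hilbert space $H$ is a positive semidefinite operator of trace $1$. For positive semidefinite $X$, $\sqrt X=X^{1/2}$ is its positive semidefinite square root. A measurement on $H$ is a finite family $\{M_i\}$ of positive semidefinite operators summing to the identity; applied to a state $\rho$, outcome $i$ occurs with probability $\operatorname{tr}(M_i\rho)$. For a measurement $\{M_i\}$ let $p_i=\operatorname{tr}(M_i\rho_0)$ and $q_i=\operatorname{tr}(M_i\rho_1)$ be the outcome distributions $P$ and $Q$. A measurement is called fidelity-optimal if it minimizes $F(P,Q)=\sum_i\sqrt{p_iq_i}$ over all measurements. (When $\rho_1$ is invertible, such a measurement is given by the orthogonal projectors on the eigenvectors, forming an orthonormal basis, of $M=\rho_1^{-1/2}\sqrt{\rho_1^{1/2}\rho_0\rho_1^{1/2}}\,\rho_1^{-1/2}$; this is a known result of Fuchs and Caves, who also show that the minimum of $F(P,Q)$ over measurements equals $F(\rho_0,\rho_1)$.) The average error probability of a test is $\frac12 \Pr(\text{choose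 }\rho_1\mid\rho_0)+\frac12\Pr(\text{choose }\rho_0\mid\rho_1)$; the maximum likelihood rule chooses the state under which the observed sequence of $N$ outcomes has the larger probability (ties broken arbitrarily). *)

(* Defs.v *)
From mathcomp Require Import all_boot all_order all_algebra.
From mathcomp Require Import complex.
From mathcomp Require Import boolp classical_sets reals.

Set Implicit Arguments.
Unset Strict Implicit.
Unset Printing Implicit Defensive.

Import Order.TTheory GRing.Theory Num.Theory.

Local Open Scope ring_scope.
Local Open Scope sesquilinear_scope.
Local Open Scope classical_set_scope.

(* Operators on an n-dimensional complex Hilbert space are n x n matrices over
   R[i] acting on column vectors, with the standard inner product. On R[i] the
   order 0 <= z means that z is real and nonnegative. *)

Definition psdmx (R : realType) (n : nat) (A : 'M[R[i]]_n) : Prop :=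
  A \is hermsymmx /\ forall v : 'cV[R[i]]_n, 0 <= (v ^t* *m A *m v) 0 0.

(* Meaningful for psdmx A, where existence and uniqueness of the square root
   are psd_sqrtmx and sqrtmx_unique below; 0 if A has no such root. *)
Definition sqrtmx (R : realType) (n : nat) (A : 'M[R[i]]_n) : 'M[R[i]]_n :=
  xget 0 [set B | psdmx B /\ B *m B = A].

Definition state (R : realType) (n : nat) (rho : 'M[R[i]]_n) : Prop :=
  psdmx rho /\ \tr rho = 1.

Definition fidelity (R : realType) (n : nat) (rho0 rho1 : 'M[R[i]]_n) : R :=
  complex.Re (\tr (sqrtmx (sqrtmx rho0 *m rho1 *m sqrtmx rho0))).

Definition measurement (R : realType) (n : nat) (I : finType)
    (M : I -> 'M[R[i]]_n) : Prop :=
  (forall i, psdmx (M i)) /\ \sum_i M i = 1%:M.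

(* The trace is real when both arguments are positive semidefinite. *)
Definition outcome_prob (R : realType) (n : nat) (I : finType)
    (M : I -> 'M[R[i]]_n) (rho : 'M[R[i]]_n) (i : I) : R :=
  complex.Re (\tr (M i *m rho)).

Definition overlap (R : realType) (I : finType) (p q : I -> R) : R :=
  \sum_i Num.sqrt (p i * q i).

Definition fidelity_optimal (R : realType) (n : nat)
    (rho0 rho1 : 'M[R[i]]_n) (I : finType) (M : I -> 'M[R[i]]_n) : Prop :=
  measurement M /\
  forall (J : finType) (M' : J -> 'M[R[i]]_n), measurement M' ->
    overlap (outcome_prob M rho0) (outcome_prob M rho1) <=
    overlap (outcome_prob M' rho0) (outcome_prob M' rho1).

(* Probability of the outcome sequence x when N independent outcomes are drawn
   from the distribution p. *)
Definition iid_prob (R : realType) (I : finType) (p : I -> R) (N : nat)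
    (x : {ffun 'I_N -> I}) : R :=
  \prod_(k < N) p (x k).

(* A decision rule d chooses rho1 on the sequences x with d x = true, and rho0
   on the others. Ties are unconstrained. *)
Definition maximum_likelihood (R : realType) (I : finType) (p q : I -> R)
    (N : nat) (d : {ffun 'I_N -> I} -> bool) : Prop :=
  forall x, (iid_prob q x < iid_prob p x -> d x = false) /\
            (iid_prob p x < iid_prob q x -> d x = true).

Definition average_error (R : realType) (I : finType) (p q : I -> R)
    (N : nat) (d : {ffun 'I_N -> I} -> bool) : R :=
  2^-1 * (\sum_(x | d x) iid_prob p x) +
  2^-1 * (\sum_(x | ~~ d x) iid_prob q x).

Section SquareRoot.
Variables (R : realType) (n : nat).
Implicit Types (A B C : 'M[R[i]]_n).

Lemma psdmx_spectral A : psdmx A ->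
  A = (spectralmx A) ^t* *m diag_mx (spectral_diag A) *m spectralmx A /\
  forall i, 0 <= spectral_diag A 0 i.
Proof.
move=> [Ah Ap]; set U := spectralmx A; set D := spectral_diag A.
have Uu : U \is unitarymx by exact: spectral_unitarymx.
have AE : A = U ^t* *m diag_mx D *m U.
  have /orthomx_spectralP := hermitian_normalmx Ah.
  by rewrite invmx_unitary.
split=> // i.
pose e : 'cV[R[i]]_n := delta_mx i 0.
have UU : U *m U ^t* = 1%:M by exact/unitarymxP.
have := Ap (U ^t* *m e).
rewrite {1}AE trmx_mul map_mxM trmxCK -!mulmxA [U *m (U ^t* *m _)]mulmxA UU.
rewrite mul1mx [U *m (U ^t* *m _)]mulmxA UU mul1mx mulmxA.
have -> : e ^t* = delta_mx 0 i by rewrite trmx_delta map_delta_mx.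
by rewrite -rowE -colE !mxE eqxx mulr1n.
Qed.

Lemma psdmx_conj_diag (U : 'M[R[i]]_n) (D : 'rV[R[i]]_n) :
  (forall i, 0 <= D 0 i) -> psdmx (U ^t* *m diag_mx D *m U).
Proof.
move=> D0; have DE : (diag_mx D) ^t* = diag_mx D.
  apply/matrixP=> i j; rewrite !mxE eq_sym.
  case: eqVneq => [->|_]; rewrite ?mulr1n ?mulr0n ?rmorph0 //.
  exact/CrealP/ger0_real.
split.
  apply/is_hermitianmxP; rewrite expr0 scale1r.
  by rewrite !trmx_mul !map_mxM trmxCK DE !mulmxA.
move=> v; set w := U *m v.
have -> : v ^t* *m (U ^t* *m diag_mx D *m U) *m v = w ^t* *m diag_mx D *m w.
  by rewrite /w trmx_mul map_mxM !mulmxA.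
rewrite !mxE sumr_ge0 // => i _; rewrite mul_mx_diag !mxE.
by rewrite mulrAC mulr_ge0 // mulrC mul_conjC_ge0.
Qed.

Lemma psd_sqrtmx_exists A : psdmx A -> exists B, psdmx B /\ B *m B = A.
Proof.
move=> /psdmx_spectral[AE D0]; set U := spectralmx A in AE.
have Uu : U \is unitarymx by exact: spectral_unitarymx.
exists (U ^t* *m diag_mx (\row_i sqrtC (spectral_diag A 0 i)) *m U).
split; first by apply: psdmx_conj_diag => i; rewrite mxE sqrtC_ge0.
rewrite {3}AE !mulmxA mulmxtVK // -[_ *m diag_mx _ *m diag_mx _]mulmxA.
congr (_ *m _ *m _); rewrite mulmx_diag; congr diag_mx.
by apply/rowP=> i; rewrite !mxE -expr2 sqrtCK.
Qed.

Lemma psd_sqrtmx_inj B C : psdmx B -> psdmx C -> B *m B = C *m C -> B = C.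
Proof.
move=> /psdmx_spectral[BE D0] /psdmx_spectral[CE E0].
set U := spectralmx B in BE; set D := spectral_diag B in BE D0.
set V := spectralmx C in CE; set E := spectral_diag C in CE E0.
have Uu : U \is unitarymx by exact: spectral_unitarymx.
have Vu : V \is unitarymx by exact: spectral_unitarymx.
move=> eqBC; pose W := V *m U ^t*.
have UV : U *m U ^t* = 1%:M by exact/unitarymxP.
have VV : V *m V ^t* = 1%:M by exact/unitarymxP.
have VVc : V ^t* *m V = 1%:M by exact: mulmx1C.
have UVc : U ^t* *m U = 1%:M by exact: mulmx1C.
have VC : V *m C = diag_mx E *m V by rewrite CE !mulmxA VV mul1mx.
have BU : B *m U ^t* = U ^t* *m diag_mx D by rewrite BE -!mulmxA UV mulmx1.
have WE : W *m diag_mx D *m diag_mx D = diag_mx E *m (diag_mx E *m W).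
  transitivity (V *m (B *m B) *m U ^t*).
    by rewrite /W -!mulmxA BU [B *m (_ *m _)]mulmxA BU -!mulmxA.
  by rewrite eqBC [V *m (C *m C)]mulmxA VC -[_ *m V *m C]mulmxA VC /W !mulmxA.
have WDE : W *m diag_mx D = diag_mx E *m W.
  apply/matrixP=> i j.
  have := congr1 (fun X : 'M_n => X i j) WE.
  rewrite !mul_mx_diag !mul_diag_mx !mxE; set w := \sum_(k < _) _.
  case: (eqVneq w 0) => [->|w0]; first by rewrite mul0r mulr0.
  rewrite -mulrA -expr2 mulrA -expr2 [RHS]mulrC => /(mulfI w0)/eqP.
  by rewrite eqrXn2 // => /eqP ->; rewrite mulrC.
have -> : B = V ^t* *m (W *m diag_mx D) *m U.
  by rewrite /W !mulmxA VVc mul1mx.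
by rewrite WDE /W !mulmxA -[_ *m U ^t* *m U]mulmxA UVc mulmx1.
Qed.

Lemma psd_sqrtmx A : psdmx A ->
  psdmx (sqrtmx A) /\ sqrtmx A *m sqrtmx A = A.
Proof. by move=> /psd_sqrtmx_exists/(xgetPex 0). Qed.

Lemma sqrtmx_unique A B : psdmx B -> B *m B = A -> sqrtmx A = B.
Proof.
move=> Bp BA; apply: xget_unique; first by split.
by move=> C [Cp CA]; apply: psd_sqrtmx_inj => //; rewrite CA.
Qed.

End SquareRoot.

(* Main.v *)
(* Since min(a, b) <= sqrt(ab), the error of the maximum likelihood rule on N
   copies is at most the overlap of the product distributions, which is the N-th
   power of the one-copy overlap. By optimality that overlap is at most the one
   of any other measurement, so it suffices to exhibit a measurement with overlap
   F(rho0, rho1). The Fuchs-Caves measurement provides one, also without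
   invertibility: compress to the support of rho0 the eigenprojectors of their
   operator, formed with pseudoinverses. *)
Require Import Defs.
From mathcomp Require Import all_boot all_order all_algebra.
From mathcomp Require Import complex.
From mathcomp Require Import boolp classical_sets reals ereal.
From mathcomp Require Import topology normedtype sequences exp.

Local Open Scope ring_scope.

Import Order.TTheory GRing.Theory Num.Theory.

(** * Positive semidefinite matrices, and a measurement attaining the fidelity *)

Section PositiveSemidefinite.
Local Open Scope sesquilinear_scope.
Context {R : realType} {n : nat}.
Implicit Types A B P Q : 'M[R[i]]_n.

Lemma psdmx_adj A : psdmx A -> A ^t* = A.
Proof. by case=> /is_hermitianmxP; rewrite expr0 scale1r => <-. Qed.

Lemma psdmx_congr Q A : psdmx A -> psdmx (Q ^t* *m A *m Q).
Proof.
move=> Ap; split.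
  apply/is_hermitianmxP; rewrite expr0 scale1r.
  by rewrite !trmx_mul !map_mxM trmxCK (psdmx_adj A Ap) !mulmxA.
move=> v; have := Ap.2 (Q *m v).
by rewrite trmx_mul map_mxM !mulmxA.
Qed.

Lemma psdmx_conj A Q : psdmx Q -> psdmx A -> psdmx (Q *m A *m Q).
Proof. by move=> Qp /(psdmx_congr Q); rewrite (psdmx_adj Q Qp). Qed.

Lemma psdmx_tr_ge0 A : psdmx A -> 0 <= \tr A.
Proof.
case=> _ Ap; apply: sumr_ge0 => i _.
have := Ap (delta_mx i 0).
by rewrite trmx_delta map_delta_mx -rowE -colE !mxE.
Qed.

(** Writing [B] as [C *m C] with [C] positive semidefinite, cyclicity turns the trace into that of
    [C *m A *m C]. *)
Lemma psdmx_tr_mul_ge0 A B : psdmx A -> psdmx B -> 0 <= \tr (A *m B).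
Proof.
move=> Ap /psd_sqrtmx_exists[C [Cp <-]].
by rewrite mulmxA mxtrace_mulC mulmxA; apply/psdmx_tr_ge0/psdmx_conj.
Qed.

Lemma psdmx_tr_mul_Re A B : psdmx A -> psdmx B ->
  (complex.Re (\tr (A *m B)))%:C%C = \tr (A *m B).
Proof. by move=> Ap Bp; apply/RRe_real/ger0_real/psdmx_tr_mul_ge0. Qed.

(** The diagonal entries of [A ^t* *m A] are the squared norms of the columns of [A]. *)
Lemma adjmx_mul_eq0 A : A ^t* *m A = 0 -> A = 0.
Proof.
move=> AA0; apply/matrixP=> i j; rewrite mxE.
have := congr1 (fun X : 'M_n => X j j) AA0; rewrite !mxE => /eqP.
rewrite psumr_eq0 => [/allP/(_ i (mem_index_enum _))|k _]; last first.
  by rewrite !mxE mulrC mul_conjC_ge0.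
by rewrite !mxE /= mulrC mul_conjC_eq0 => /eqP.
Qed.

(* [B] is the Moore-Penrose inverse of [A], and [P] the projector onto the
   support of [A]. *)
Lemma psdmx_pinv A : psdmx A -> exists B P,
  [/\ psdmx B, psdmx P & psdmx (1%:M - P)] /\
  [/\ A *m B = P, B *m A = P & A *m P = A].
Proof.
move=> /psdmx_spectral[AE D0].
set U := spectralmx A in AE; set D := spectral_diag A in AE D0.
have UU : U *m U ^t* = 1%:M by exact/unitarymxP/spectral_unitarymx.
have UcU : U ^t* *m U = 1%:M by exact: mulmx1C.
(* Functional calculus in the eigenbasis of [A]: [f] sends entrywise products to matrix products. *)
pose f (E : 'rV_n) := U ^t* *m diag_mx E *m U.
have fM E F : f E *m f F = f (\row_i (E 0 i * F 0 i)).
  rewrite /f !mulmxA -[_ *m U *m U ^t*]mulmxA UU mulmx1.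
  by rewrite -[_ *m diag_mx E *m diag_mx F]mulmxA mulmx_diag.
have f1 : f (\row_i 1) = 1%:M.
  rewrite /f (_ : diag_mx _ = 1%:M) ?mulmx1 //.
  by apply/matrixP=> i j; rewrite !mxE.
(* Since [0^-1 = 0], inverting the eigenvalues entrywise leaves the kernel of [A] at zero. *)
pose B := f (\row_i (D 0 i)^-1); pose P := f (\row_i (D 0 i != 0)%:R).
exists B, P; split; split.
- by apply: psdmx_conj_diag => i; rewrite mxE invr_ge0.
- by apply: psdmx_conj_diag => i; rewrite mxE ler0n.
- rewrite -f1 /P /f -mulmxBl -mulmxBr -raddfB /=.
  apply: psdmx_conj_diag => i; rewrite !mxE.
  by case: (_ != _); rewrite ?subrr ?subr0.
- rewrite AE -/(f D) fM; congr f; apply/rowP => i; rewrite !mxE.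
  by case: eqVneq => [->|d0]; rewrite ?mul0r ?mulfV.
- rewrite AE -/(f D) fM; congr f; apply/rowP => i; rewrite !mxE.
  by case: eqVneq => [->|d0]; rewrite ?mulr0 ?mulVf.
- rewrite AE -/(f D) fM; congr f; apply/rowP => i; rewrite !mxE.
  by case: eqVneq => [->|d0]; rewrite ?mulr0 ?mulr1.
Qed.

(** There is one rank-one projector per vector of an eigenbasis, so the values [l i] may repeat. *)
Lemma psdmx_eigenprojectors A : psdmx A ->
  exists (E : 'I_n -> 'M[R[i]]_n) (l : 'I_n -> R),
  [/\ forall i, psdmx (E i), \sum_i E i = 1%:M, forall i, 0 <= l i &
      forall i, A *m E i = (l i)%:C%C *: E i /\ E i *m A = (l i)%:C%C *: E i].
Proof.
move=> /psdmx_spectral[AE D0].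
set U := spectralmx A in AE; set D := spectral_diag A in AE D0.
have UU : U *m U ^t* = 1%:M by exact/unitarymxP/spectral_unitarymx.
have UcU : U ^t* *m U = 1%:M by exact: mulmx1C.
have DR i : (complex.Re (D 0 i))%:C%C = D 0 i by apply/RRe_real/ger0_real.
pose E i := U ^t* *m diag_mx (delta_mx 0 i) *m U.
exists E, (fun i => complex.Re (D 0 i)); split => [i||i|i].
- by apply: psdmx_conj_diag => j; rewrite mxE ler0n.
- rewrite /E -mulmx_suml -mulmx_sumr -raddf_sum /=.
  rewrite (_ : diag_mx _ = 1%:M) ?mulmx1 //.
  apply/matrixP => j k; rewrite !mxE summxE (bigD1 j) //= big1 => [|i /negPf ij].
    by rewrite !mxE !eqxx addr0.
  by rewrite !mxE eq_sym ij.
- by rewrite -ler0c DR.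
- have DE : diag_mx D *m diag_mx (delta_mx 0 i) = D 0 i *: diag_mx (delta_mx 0 i).
    rewrite mulmx_diag; apply/matrixP => j k; rewrite !mxE eqxx /=.
    by case: (eqVneq j i) => [->|_]; rewrite ?mulr1 ?mulr0 ?mul0rn ?mulr0 // mulr_natr.
  have ED : diag_mx (delta_mx 0 i) *m diag_mx D = D 0 i *: diag_mx (delta_mx 0 i).
    by rewrite -DE !mulmx_diag; congr diag_mx; apply/rowP=> j; rewrite !mxE mulrC.
  rewrite DR AE /E; split; rewrite !mulmxA -[_ *m U *m U ^t*]mulmxA UU mulmx1.
    by rewrite -[_ *m diag_mx D *m _]mulmxA DE -scalemxAr -scalemxAl.
  by rewrite -[_ *m diag_mx D]mulmxA ED -scalemxAr -scalemxAl.
Qed.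

(* With A = sqrt rho0, B its pseudoinverse and P the projector onto its support,
   the operator M = B sqrt(A rho1 A) B satisfies M rho0 M = P rho1 P, so that for
   each eigenprojector E of M, with eigenvalue l, the outcome P E P has
   probabilities related by q = l^2 p. The outcome 1 - P has p = 0. *)
Lemma fidelity_attained (rho0 rho1 : 'M[R[i]]_n) : psdmx rho0 -> psdmx rho1 ->
  exists (J : finType) (M : J -> 'M[R[i]]_n), measurement M /\
    overlap (outcome_prob M rho0) (outcome_prob M rho1) = fidelity rho0 rho1.
Proof.
move=> rho0p rho1p; have [] := psd_sqrtmx rho0p.
rewrite /fidelity; move: (sqrtmx rho0) => A Ap A2.
have [] := psd_sqrtmx (psdmx_conj _ _ Ap rho1p).
move: (sqrtmx (A *m rho1 *m A)) => X Xp X2.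
have [B [P [[Bp Pp P'p] [AB BA AP]]]] := psdmx_pinv _ Ap.
have PA : P *m A = A.
  by rewrite -[RHS](psdmx_adj _ Ap) -{2}AP trmx_mul map_mxM !psdmx_adj.
(* [X *m X = A *m rho1 *m A] kills [1 - P] because [A *m P = A]; hence so does [X]. *)
have XP : X *m P = X.
  suff /adjmx_mul_eq0/eqP : (X *m (1%:M - P)) ^t* *m (X *m (1%:M - P)) = 0.
    by rewrite mulmxBr mulmx1 subr_eq0 => /eqP.
  rewrite trmx_mul map_mxM !psdmx_adj // !mulmxA -[_ *m X *m X]mulmxA X2.
  by rewrite -!mulmxA [A *m (_ - _)]mulmxBr mulmx1 AP subrr !mulmx0.
have PX : P *m X = X.
  by rewrite -[RHS](psdmx_adj _ Xp) -{2}XP trmx_mul map_mxM !psdmx_adj.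
pose M := B *m X *m B.
have Mp : psdmx M by exact: psdmx_conj.
(* In [B X (B A) (A B) X B] both inner factors are [P] and are absorbed by [X]; what remains is
   [B X X B = (B A) rho1 (A B)]. *)
have MrM : M *m rho0 *m M = P *m rho1 *m P.
  rewrite -A2 /M !mulmxA.
  have -> : B *m X *m B *m A *m A *m B *m X *m B =
      B *m (X *m (B *m A)) *m ((A *m B) *m X) *m B by rewrite !mulmxA.
  by rewrite BA AB XP PX -[B *m X *m X]mulmxA X2 !mulmxA BA -mulmxA AB.
have trM : \tr (M *m rho0) = \tr X.
  rewrite -A2 /M -!mulmxA [B *m (A *m _)]mulmxA BA PA mxtrace_mulC -mulmxA AB.
  by rewrite XP.
have PrP : P *m rho0 *m P = rho0 by rewrite -A2 !mulmxA PA -mulmxA AP.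
clearbody M.
have [E [l [Ep E1 l0 ME]]] := psdmx_eigenprojectors _ Mp.
(* The compressed projectors sum only to [P]; the extra outcome completes them to the identity. *)
pose F (j : 'I_n + unit) := if j is inl i then P *m E i *m P else 1%:M - P.
have PP : P *m P = P by rewrite -{1}BA -mulmxA AP BA.
have Fm : measurement F.
  split; first by case=> [i|[]] /=; [apply: psdmx_conj (Ep i) |].
  rewrite big_sumType /= -mulmx_suml -mulmx_sumr E1 mulmx1 PP.
  by rewrite (big_pred1 tt) => [|[]//]; rewrite addrC subrK.
exists ('I_n + unit)%type, F; split; first exact: Fm.
have trPEP rho i : \tr (P *m E i *m P *m rho) = \tr (E i *m (P *m rho *m P)).
  by rewrite -!mulmxA mxtrace_mulC !mulmxA.
pose a i := complex.Re (\tr (E i *m rho0)).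
have aE i : (a i)%:C%C = \tr (E i *m rho0).
  exact: (psdmx_tr_mul_Re _ _ (Ep i) rho0p).
have a0 i : 0 <= a i.
  by rewrite -ler0c aE (psdmx_tr_mul_ge0 _ _ (Ep i) rho0p).
have p0 i : outcome_prob F rho0 (inl i) = a i.
  by rewrite /outcome_prob /= trPEP PrP.
have p1 i : outcome_prob F rho1 (inl i) = l i ^+ 2 * a i.
  rewrite /outcome_prob /= trPEP -MrM !mulmxA mxtrace_mulC !mulmxA.
  rewrite (ME i).1 -!scalemxAl (ME i).2 -!scalemxAl !mxtraceZ -aE -!rmorphM /=.
  by rewrite mulrA.
have pN : outcome_prob F rho0 (inr tt) = 0.
  by rewrite /outcome_prob /= mulmxBl mul1mx -{2}A2 mulmxA PA A2 subrr raddf0.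
rewrite /overlap big_sumType /= (big_pred1 tt) => [|[]//].
rewrite pN mul0r sqrtr0 addr0 -trM.
(* Each term is the square root of [(l i * a i) ^+ 2]; inserting the resolution of identity [E1]
   into the trace of [M *m rho0] gives the same sum. *)
transitivity (\sum_i l i * a i).
  apply: eq_bigr => i _; rewrite p0 p1 mulrCA -expr2 -exprMn sqrtr_sqr.
  by rewrite ger0_norm // mulr_ge0.
rewrite -[in RHS](mulmx1 M) -E1 mulmx_sumr mulmx_suml.
rewrite (raddf_sum (@mxtrace _ n)) (raddf_sum (@complex.Re R)).
apply: eq_bigr => i _ /=; rewrite (ME i).1 -scalemxAl mxtraceZ -aE -rmorphM.
reflexivity.
Qed.
End PositiveSemidefinite.

(** * Classical error bound for independent outcomes *)

Lemma sqrtr_prod (R : realType) (J : Type) (r : seq J) (f : J -> R) : (forall j, 0 <= f j) ->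
  Num.sqrt (\prod_(j <- r) f j) = \prod_(j <- r) Num.sqrt (f j).
Proof.
move=> f0; elim: r => [|j r IH]; first by rewrite !big_nil sqrtr1.
by rewrite !big_cons sqrtrM // IH.
Qed.

Lemma le_sqrtrM (R : realType) (x y : R) : 0 <= x -> x <= y -> x <= Num.sqrt (x * y).
Proof.
move=> x0 xy; rewrite -{1}(ger0_norm x0) -sqrtr_sqr ler_wsqrtr // expr2.
exact: ler_wpM2l.
Qed.

(** Distributivity expands the power of the one-copy sum into a sum over all outcome sequences. *)
Lemma overlap_iid (R : realType) (I : finType) (p q : I -> R) N :
  (forall i, 0 <= p i) -> (forall i, 0 <= q i) ->
  overlap (@iid_prob R I p N) (@iid_prob R I q N) = overlap p q ^+ N.
Proof.
move=> p0 q0.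
rewrite /overlap -[in RHS](card_ord N) -prodr_const bigA_distr_bigA /=.
apply: eq_bigr => x _; rewrite -big_split sqrtr_prod //= => k.
exact: mulr_ge0.
Qed.

(** On each sequence the rule errs with the smaller of the two probabilities. The prior factor 1/2
    is simply bounded by 1. *)
Lemma average_error_le (R : realType) (I : finType) (p q : I -> R) N
    (d : {ffun 'I_N -> I} -> bool) :
  (forall i, 0 <= p i) -> (forall i, 0 <= q i) ->
  maximum_likelihood p q d -> average_error p q d <= overlap p q ^+ N.
Proof.
move=> p0 q0 ml; have pN x : 0 <= @iid_prob R I p N x by apply: prodr_ge0.
have qN x : 0 <= @iid_prob R I q N x by apply: prodr_ge0.
have err : \sum_(x | d x) iid_prob p x + \sum_(x | ~~ d x) iid_prob q x <=
    overlap p q ^+ N.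
  rewrite -(@overlap_iid R I p q N p0 q0) /overlap [in leRHS](bigID d) /=; apply: lerD.
    apply: ler_sum => x dx; apply: le_sqrtrM; first exact: pN.
    by rewrite leNgt; apply/negP => /(ml x).1; rewrite dx.
  apply: ler_sum => x /negP dx; rewrite mulrC; apply: le_sqrtrM; first exact: qN.
  by rewrite leNgt; apply/negP => /(ml x).2.
rewrite /average_error -mulrDr ler_pdivrMl // (le_trans err) // mulr_natl mulr2n.
by rewrite lerDl exprn_ge0 // sumr_ge0 // => i _; rewrite sqrtr_ge0.
Qed.

Theorem theorem5p3 (R : realType) (n : nat) (rho0 rho1 : 'M[R[i]]_n)
    (I : finType) (M : I -> 'M[R[i]]_n)
    (d : forall N : nat, {ffun 'I_N -> I} -> bool) :
  state rho0 -> state rho1 ->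
  fidelity_optimal rho0 rho1 M ->
  (forall N : nat,
     maximum_likelihood (outcome_prob M rho0) (outcome_prob M rho1) (d N)) ->
  (limn_esup (fun N : nat =>
     ((N%:R : R)^-1)%:E *
     lne (average_error (outcome_prob M rho0) (outcome_prob M rho1) (d N))%:E)
   <= lne (fidelity rho0 rho1)%:E)%E.
Proof.
move=> [rho0p _] [rho1p _] [[Mp _] Mopt] ml.
set p := outcome_prob M rho0 in Mopt ml *.
set q := outcome_prob M rho1 in Mopt ml *.
have prob_ge0 rho i : psdmx rho -> 0 <= outcome_prob M rho i.
  move=> rhop; rewrite -ler0c /outcome_prob (psdmx_tr_mul_Re _ _ (Mp i) rhop).
  exact: (psdmx_tr_mul_ge0 _ _ (Mp i) rhop).
have S0 : 0 <= overlap p q by apply: sumr_ge0 => i _; apply: sqrtr_ge0.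
have SF : overlap p q <= fidelity rho0 rho1.
  have [J [M' [M'm <-]]] := fidelity_attained _ _ rho0p rho1p.
  exact: Mopt.
rewrite /limn_esup /limf_esup; apply: ge_ereal_inf.
(* The bound holds at every positive [N], so one tail suffices. It starts at 1 to make [N%:R]
   invertible. *)
exists (ereal_sup ((fun N : nat =>
     ((N%:R : R)^-1)%:E * lne (average_error p q (d N))%:E)%E
     @` [set N | (0 < N)%N])%classic).
  by exists [set N | (0 < N)%N]%classic => //; exists 1%N.
apply: ge_ereal_sup => _ [N N0 <-].
rewrite lee_pdivrMl ?ltr0n //.
have eF : average_error p q (d N) <= fidelity rho0 rho1 ^+ N.
  apply: le_trans (lerXn2r _ _ _ SF); rewrite ?nnegrE ?(le_trans S0) //.
  by apply: average_error_le => // i; apply: prob_ge0.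
(* If the error vanishes, its logarithm is [-oo]. Otherwise [eF] with [0 < N] forces a positive
   fidelity, and both logarithms are finite. *)
have [e0|e0] := leP (average_error p q (d N)) 0.
  by rewrite [leLHS]le0_lneNy ?lee_fin ?leNye.
have F0 : 0 < fidelity rho0 rho1.
  rewrite lt_neqAle (le_trans S0 SF) andbT; apply/eqP => F0.
  by move: eF; rewrite -F0 expr0n eqn0Ngt N0 leNgt e0.
rewrite !lne_EFin // -EFinM lee_fin mulr_natl -lnXn // ler_ln // posrE //.
exact: exprn_gt0.
Qed.
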